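(* Suppose that the state and input trajectories $x:[0,T]\to\mathbb{R}^n$ and $u:[0,T]\to\mathbb{R}^m$ satisfy the well-behavedness assumption described in the context. Then the data $(x,u)$ are informative for quadratic stabilization if and only if there exist $K\in\mathbb{R}^{m\times n}$, $P\in\mathbb{R}^{n\times n}$ and $\beta>0$ such that $P>0$ and $$-\begin{bmatrix} Q+\beta I_n & P & PK^\top\\ P&0&0\\ KP&0&0\end{bmatrix}+\int_0^T \begin{pmatrix}\dot x(t)\\-x(t)\\-u(t)\end{pmatrix}\begin{pmatrix}\dot x(t)\\-x(t)\\-u(t)\end{pmatrix}^\top dt\ \geq\ 0 .$$
   Context: Matrix inequalities $\geq,\leq,>,<$ are in the semidefinite (Loewner) order on symmetric matrices; $P>0$ includes symmetry of $P$. Fix $T>0$, a symmetric $Q\in\mathbb{R}^{n\times n}$ with $Q\geq 0$, and (unknown) true system matrices $A_s\in\mathbb{R}^{n\times n}$, $B_s\in\mathbb{R}^{n\times m}$. Noise model: $\Delta$ is the set of signals $w:[0,T]\to\mathbb{R}^n$ with $\int_0^T w(t)w(t)^\top dt\leq Q$. Well-behavedness assumption on $(x,u)$: $x$ is absolutely continuous (with $\dot x$ its almost everywhere defined derivative); $u$ is square integrable; the corresponding noise signal $w:[0,T]\to\mathbb{R}^n$ belongs to $\Delta$; and $\dot x(t)=A_sx(t)+B_su(t)+w(t)$ for almost all $t\in[0,T]$. Set of consistent systems: $\Sigma=\{(A,B)\in\mathbb{R}^{n\times n}\times\mathbb{R}^{n\times m}\mid \dot x-Ax-Bu\in\Delta\}$.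 The data $(x,u)$ are informative for quadratic stabilization if there exist $K\in\mathbb{R}^{m\times n}$ and $P\in\mathbb{R}^{n\times n}$ with $P>0$ such that $(A+BK)P+P(A+BK)^\top<0$ for all $(A,B)\in\Sigma$. *)

(* Defs.v *)
From HB Require Import structures.
From mathcomp Require Import all_boot all_order all_algebra.
From mathcomp Require Import all_classical all_reals all_analysis.

Set Implicit Arguments.
Unset Strict Implicit.
Unset Printing Implicit Defensive.

Import Order.TTheory GRing.Theory Num.Theory.
Import numFieldNormedType.Exports.

Local Open Scope classical_set_scope.
Local Open Scope ring_scope.

(* Loewner order.  Semidefiniteness and definiteness include symmetry. *)
Definition psd (R : realType) (p : nat) (M : 'M[R]_p) : Prop :=
  M^T = M /\ forall v : 'cV[R]_p, 0 <= (v^T *m M *m v) 0 0.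

Definition pd (R : realType) (p : nat) (M : 'M[R]_p) : Prop :=
  M^T = M /\ forall v : 'cV[R]_p, v != 0 -> 0 < (v^T *m M *m v) 0 0.

Definition loewner_le (R : realType) (p : nat) (M N : 'M[R]_p) : Prop :=
  psd (N - M).

Definition loewner_lt (R : realType) (p : nat) (M N : 'M[R]_p) : Prop :=
  pd (N - M).

(* A signal [0,T] -> R^p is represented by a total function R -> 'cV[R]_p of
   which only the restriction to [0,T] matters.  Measurability and integrals are
   those of the complete Lebesgue measure, so that they are insensitive to
   modifications on (possibly non Borel) null sets; in particular a function
   that is only defined almost everywhere can be extended arbitrarily. *)
Definition mx_integral (R : realType) (T : R) (p q : nat)
    (F : R -> 'M[R]_(p, q)) : 'M[R]_(p, q) :=
  \matrix_(i, j) (\int[@completed_lebesgue_measure R]_(t in `[0, T]) F t i j).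

Definition square_integrable (R : realType) (T : R) (p : nat)
    (v : R -> 'cV[R]_p) : Prop :=
  forall i : 'I_p,
    measurable_fun (`[0, T] : set (caratheodory_type (wlength idfun)^*%mu))
      (fun t => v t i 0) /\
    (@completed_lebesgue_measure R).-integrable `[0, T]
      (fun t => ((v t i 0) ^+ 2)%:E).

Definition absolutely_continuous (R : realType) (V : normedModType R)
    (a b : R) (f : R -> V) : Prop :=
  forall e : R, 0 < e -> exists2 d : R, 0 < d &
    forall (k : nat) (l r : 'I_k -> R),
      (forall i, a <= l i /\ l i <= r i /\ r i <= b) ->
      trivIset [set: 'I_k] (fun i => `]l i, r i[%classic) ->
      \sum_i (r i - l i) < d ->
      \sum_i `|f (r i) - f (l i)| < e.

(* Square integrability expresses that the matrix integral exists. *)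
Definition noise_set (R : realType) (n : nat) (T : R) (Q : 'M[R]_n) :
    set (R -> 'cV[R]_n) :=
  [set w | square_integrable T w /\
    loewner_le (mx_integral T (fun t => w t *m (w t)^T)) Q].

(* [derive1 x t] is the limit of the difference quotients at t, hence the
   derivative of x at almost every t in [0,T] when x is absolutely continuous
   there; its values on the exceptional null set (including 0 and T) are
   immaterial. *)
Definition well_behaved (R : realType) (n m : nat) (T : R) (Q : 'M[R]_n)
    (As : 'M[R]_n) (Bs : 'M[R]_(n, m))
    (x : R -> 'cV[R]_n) (u : R -> 'cV[R]_m) : Prop :=
  [/\ absolutely_continuous 0 T x,
      square_integrable T u &
      exists2 w : R -> 'cV[R]_n, noise_set T Q w &
        ae_eq (@completed_lebesgue_measure R) `[0, T]%classic
          (derive1 x) (fun t : R => As *m x t + Bs *m u t + w t)].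

Definition consistent_systems (R : realType) (n m : nat) (T : R) (Q : 'M[R]_n)
    (x : R -> 'cV[R]_n) (u : R -> 'cV[R]_m) :
    set ('M[R]_n * 'M[R]_(n, m)) :=
  [set AB | noise_set T Q (fun t => derive1 x t - AB.1 *m x t - AB.2 *m u t)].

Definition informative_quadratic_stabilization (R : realType) (n m : nat)
    (T : R) (Q : 'M[R]_n) (x : R -> 'cV[R]_n) (u : R -> 'cV[R]_m) : Prop :=
  exists (K : 'M[R]_(m, n)) (P : 'M[R]_n),
    loewner_lt 0 P /\
    forall (A : 'M[R]_n) (B : 'M[R]_(n, m)),
      consistent_systems T Q x u (A, B) ->
      loewner_lt ((A + B *m K) *m P + P *m (A + B *m K)^T) 0.

Definition data_vector (R : realType) (n m : nat)
    (x : R -> 'cV[R]_n) (u : R -> 'cV[R]_m) (t : R) : 'cV[R]_(n + (n + m)) :=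
  col_mx (derive1 x t) (col_mx (- x t) (- u t)).

(* Main.v *)
Require Import Defs.
From HB Require Import structures.
From mathcomp Require Import all_boot all_order all_algebra.
From mathcomp Require Import all_classical all_reals all_analysis.
From mathcomp Require Import measurable_realfun ring lra.

Set Implicit Arguments.
Unset Strict Implicit.
Unset Printing Implicit Defensive.

Import Order.TTheory GRing.Theory Num.Theory.
Import numFieldNormedType.Exports.

Local Open Scope classical_set_scope.
Local Open Scope ring_scope.

(** Let Z be the Gram matrix of the data vector (x', -x, -u) over [0, T]. The
    residual x' - A x - B u is [I, A, B] applied to the data vector, so (A, B) is
    consistent exactly when [I, A, B] Z [I, A, B]^T <= Q. This is a quadratic
    inequality in X = [A, B]^T, called [admissible] ([consistent_admissible]).
    With L = P [I, K^T], the closed-loop Lyapunov form at v is 2 v^T L X v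
    ([closed_loop_form]), and the linear matrix inequality says that
      qf Z v y - v^T Q v - beta |v|^2 - 2 v^T L y >= 0   for all v and y
    ([lmi_form]).

    If the linear matrix inequality holds, taking y = X v with X admissible gives
    2 v^T L X v <= - beta |v|^2, hence stabilization by K.

    The converse is a matrix S-lemma ([matrix_S_lemma]): the inequality must follow
    from v^T L X v < 0 for all admissible X and v != 0. Completing the square in y
    shows that the set of admissible X is a matrix ellipsoid, possibly unbounded,
    nonempty because the true system belongs to it. Each pair (v, y) with v != 0
    and qf Z v y <= v^T Q v satisfies y = X v for some admissible X, obtained by a
    rank one correction of the centre ([admissible_through]). Thus v^T L y < 0
    whenever qf Z v y - v^T Q v <= 0 and v != 0. The strict S-lemma for two scalar
    quadratic forms ([strict_S_lemma]) then yields a positive multiplier, which is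
    absorbed in P and beta.

    The lower right block W of Z may be singular. The directions of ker W are in the
    radical of Z ([range_proj]), and L vanishes on them because the admissible set
    is unbounded along them ([neg_mul_proj]); so y may be restricted to the range
    of W, where the pair of forms becomes strict.

    On the analytic side, an absolutely continuous x is continuous, hence square
    integrable, and so is x' through the differential equation; every entry of Z
    is therefore a convergent integral and v^T Z v is the integral of a square
    ([well_behaved_data], [bform_gram]). *)

(** * Bilinear forms given by matrices *)

Definition bform (R : pzRingType) (p q : nat) (M : 'M[R]_(p, q))
    (a : 'cV[R]_p) (b : 'cV[R]_q) : R := (a^T *m M *m b) 0 0.

Section Bform.
Variable (R : comPzRingType).

Lemma bformDl p q (M : 'M[R]_(p, q)) a a' b :
  bform M (a + a') b = bform M a b + bform M a' b.
Proof. by rewrite /bform linearD /= !mulmxDl mxE. Qed.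

Lemma bformDr p q (M : 'M[R]_(p, q)) a b b' :
  bform M a (b + b') = bform M a b + bform M a b'.
Proof. by rewrite /bform mulmxDr mxE. Qed.

Lemma bformZl p q (M : 'M[R]_(p, q)) s a b :
  bform M (s *: a) b = s * bform M a b.
Proof. by rewrite /bform linearZ /= -!scalemxAl mxE. Qed.

Lemma bformZr p q (M : 'M[R]_(p, q)) s a b :
  bform M a (s *: b) = s * bform M a b.
Proof. by rewrite /bform -scalemxAr mxE. Qed.

Lemma bform0l p q (M : 'M[R]_(p, q)) b : bform M 0 b = 0.
Proof. by rewrite /bform linear0 !mul0mx mxE. Qed.

Lemma bform0r p q (M : 'M[R]_(p, q)) a : bform M a 0 = 0.
Proof. by rewrite /bform mulmx0 mxE. Qed.

Lemma bformD p q (M N : 'M[R]_(p, q)) a b :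
  bform (M + N) a b = bform M a b + bform N a b.
Proof. by rewrite /bform mulmxDr mulmxDl mxE. Qed.

Lemma bformN p q (M : 'M[R]_(p, q)) a b : bform (- M) a b = - bform M a b.
Proof. by rewrite /bform mulmxN mulNmx mxE. Qed.

Lemma bformB p q (M N : 'M[R]_(p, q)) a b :
  bform (M - N) a b = bform M a b - bform N a b.
Proof. by rewrite bformD bformN. Qed.

Lemma bformZ p q (M : 'M[R]_(p, q)) s a b :
  bform (s *: M) a b = s * bform M a b.
Proof. by rewrite /bform -scalemxAr -scalemxAl mxE. Qed.

Lemma bform0 p q a b : bform (0 : 'M[R]_(p, q)) a b = 0.
Proof. by rewrite /bform mulmx0 mul0mx mxE. Qed.

Lemma bformT p q (M : 'M[R]_(p, q)) a b : bform M^T a b = bform M b a.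
Proof.
rewrite /bform; have -> : a^T *m M^T *m b = (b^T *m M *m a)^T.
  by rewrite !trmx_mul trmxK mulmxA.
by rewrite mxE.
Qed.

Lemma bform_mul p q r s (A : 'M[R]_(p, q)) (M : 'M[R]_(q, r))
    (B : 'M[R]_(r, s)) a b :
  bform (A *m M *m B) a b = bform M (A^T *m a) (B *m b).
Proof. by rewrite /bform trmx_mul trmxK !mulmxA. Qed.

Lemma bform_block p q r s (A : 'M[R]_(p, r)) (B : 'M[R]_(p, s))
    (C : 'M[R]_(q, r)) (D : 'M[R]_(q, s)) a b c d :
  bform (block_mx A B C D) (col_mx a b) (col_mx c d) =
  bform A a c + bform B a d + bform C b c + bform D b d.
Proof.
rewrite /bform tr_col_mx mul_row_block mul_row_col !mulmxDl !mxE; ring.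
Qed.

Lemma bform1_mulmx p q (A : 'M[R]_(p, q)) a b :
  bform 1%:M (A *m a) b = bform A^T a b.
Proof. by rewrite /bform mulmx1 trmx_mul. Qed.

End Bform.

Section RealForms.
Variable R : realFieldType.

Lemma bform1_ge0 p (a : 'cV[R]_p) : 0 <= bform 1%:M a a.
Proof.
rewrite /bform mulmx1 mxE; apply: sumr_ge0 => i _.
by rewrite mxE -expr2 sqr_ge0.
Qed.

Lemma bform1_eq0 p (a : 'cV[R]_p) : (bform 1%:M a a == 0) = (a == 0).
Proof.
apply/eqP/eqP => [|->]; last exact: bform0r.
rewrite /bform mulmx1 mxE => /eqP; rewrite psumr_eq0; last first.
  by move=> i _; rewrite mxE -expr2 sqr_ge0.
move=> /allP h; apply/colP => i; rewrite mxE.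
have := h i; rewrite mem_index_enum mxE -expr2 sqrf_eq0 => /(_ isT) /eqP.
by [].
Qed.

Lemma bform1_gt0 p (a : 'cV[R]_p) : a != 0 -> 0 < bform 1%:M a a.
Proof. by rewrite lt0r bform1_eq0 bform1_ge0 andbT. Qed.

Lemma gram_eq0 p q (M : 'M[R]_(p, q)) : M^T *m M = 0 -> M = 0.
Proof.
move=> h; apply/matrixP => i j; rewrite [RHS]mxE.
have /eqP : bform 1%:M (M *m delta_mx j 0) (M *m delta_mx j 0) = 0 :> R.
  by rewrite -{1}[M]trmxK -bform_mul mulmx1 h bform0.
by rewrite bform1_eq0 -colE => /eqP /colP /(_ i); rewrite !mxE.
Qed.

(** Cauchy-Schwarz for a form that may be degenerate. *)
Lemma bform_CauchySchwarz p (M : 'M[R]_p) a b : M^T = M ->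
  (forall v, 0 <= bform M v v) ->
  bform M a b ^+ 2 <= bform M a a * bform M b b.
Proof.
move=> sM pM.
have e s t : bform M (s *: a + t *: b) (s *: a + t *: b) =
    s ^+ 2 * bform M a a + 2 * (s * t) * bform M a b + t ^+ 2 * bform M b b.
  rewrite !(bformDl, bformDr, bformZl, bformZr) -[bform M b a]bformT sM; ring.
have ha := pM a; have hb := pM b.
(* An isotropic a: the form is affine in s, and the chosen point would make it
   negative unless bform M a b = 0. *)
have [a0|a0] := eqVneq (bform M a a) 0.
  have := pM ((- (bform M b b + 1)) *: a + (bform M a b) *: b).
  rewrite e a0; nra.
have {}a0 : 0 < bform M a a by rewrite lt0r a0.
have := pM ((- bform M a b) *: a + (bform M a a) *: b).
rewrite e => h.
rewrite -subr_ge0 -(pmulr_rge0 _ a0); nra.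
Qed.

(** [D *m W] is the orthogonal projection onto the range of [W]. Such a [D] exists
    because a symmetric real matrix satisfies ker W^2 = ker W, so that the rows
    of [W] are combinations of the rows of W^2. *)
Lemma sym_pinv p (W : 'M[R]_p) : W^T = W ->
  exists2 D : 'M[R]_p, D *m W *m W = W & (D *m W)^T = D *m W.
Proof.
move=> sW.
have /submxP[D] : (W <= W *m W)%MS.
  rewrite submxE; apply/eqP; apply: gram_eq0.
  rewrite trmx_mul sW -mulmxA [W *m (W *m _)]mulmxA.
  by rewrite (mulmx_coker (W *m W)) mulmx0.
rewrite mulmxA => DE; exists D; first by rewrite -DE.
have WE : W = W *m W *m D^T.
  by rewrite -[LHS]sW [in LHS]DE !trmx_mul sW mulmxA.
by rewrite trmx_mul sW [in RHS]WE !mulmxA -DE.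
Qed.

(** By Cauchy-Schwarz, an isotropic vector of a semidefinite form lies in its
    radical. *)
Lemma psd_radical p (M : 'M[R]_p) a v : M^T = M ->
  (forall v, 0 <= bform M v v) -> bform M v v = 0 -> bform M a v = 0.
Proof.
move=> sM pM v0; apply/eqP; rewrite -sqrf_eq0 eq_le sqr_ge0 andbT.
by rewrite (le_trans (bform_CauchySchwarz _ _ sM pM)) // v0 mulr0.
Qed.

(** * Completing the square in a semidefinite block form *)

Section Blocks.
Variables (n k : nat) (Z : 'M[R]_(n + k)).
Hypotheses (sZ : Z^T = Z) (pZ : forall z, 0 <= bform Z z z).

Definition qf v y := bform Z (col_mx v y) (col_mx v y).

Let W := drsubmx Z.

Lemma bform_dr a b : bform Z (col_mx 0 a) (col_mx 0 b) = bform W a b.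
Proof.
by rewrite -[Z]submxK bform_block !(bform0l, bform0r) !add0r.
Qed.

Lemma bform_dl a b :
  bform Z (col_mx 0 a) (col_mx b 0) = bform (dlsubmx Z) a b.
Proof.
by rewrite -[Z in LHS]submxK bform_block !(bform0l, bform0r) !add0r addr0.
Qed.

(** The second coordinate matters only through its projection onto the range of
    the lower right block [W]: a vector of ker W is isotropic for [Z], hence in
    the radical of [Z]. *)
Lemma range_proj : exists E : 'M[R]_k,
  [/\ E *m E = E, exists D, E = D *m W &
      forall a y, bform Z a (col_mx 0 (y - E *m y)) = 0].
Proof.
have sW : W^T = W by rewrite /W trmx_drsub sZ.
have [D DWW sDW] := sym_pinv sW.
have WDW : W *m (D *m W) = W.
  by rewrite -{1}sW -{1}sDW -trmx_mul DWW.
exists (D *m W); split; [by rewrite -mulmxA WDW|by exists D|] => a y.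
apply: psd_radical => //; rewrite bform_dr /bform -mulmxA mulmxBr.
by rewrite [W *m (D *m W *m y)]mulmxA WDW subrr mulmx0 mxE.
Qed.

(** For fixed [v], the minimum of [qf v y] over [y] is attained at a point that
    depends linearly on [v]; the equation is the normal equation
    [W *m X0 = - dlsubmx Z], solvable although [W] may be singular. *)
Lemma center_exists : exists X0 : 'M[R]_(k, n), forall v y,
  bform Z (col_mx 0 y) (col_mx v (X0 *m v)) = 0.
Proof.
have [E [_ [D ED] EP]] := range_proj.
have sW : W^T = W by rewrite /W trmx_drsub sZ.
exists (- (D^T *m dlsubmx Z)) => v y.
have -> : col_mx v (- (D^T *m dlsubmx Z) *m v) =
    col_mx v 0 + col_mx 0 (- (D^T *m dlsubmx Z) *m v).
  by rewrite add_col_mx addr0 add0r.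
rewrite bformDr bform_dr mulNmx -scaleN1r bformZr mulN1r.
have -> : bform W y (D^T *m dlsubmx Z *m v) = bform (dlsubmx Z) (E *m y) v.
  by rewrite /bform trmx_mul ED trmx_mul sW !mulmxA.
have EP0 := EP (col_mx v 0) y; rewrite -bformT sZ in EP0.
rewrite bform_dl.
move: EP0; rewrite bform_dl -scaleN1r bformDl bformZl mulN1r => /eqP.
by rewrite subr_eq0 => /eqP ->; rewrite subrr.
Qed.

Lemma qf_center X0 v y :
  (forall v y, bform Z (col_mx 0 y) (col_mx v (X0 *m v)) = 0) ->
  qf v y = qf v (X0 *m v) + bform W (y - X0 *m v) (y - X0 *m v).
Proof.
move=> h; have h' a : bform Z (col_mx v (X0 *m v)) (col_mx 0 a) = 0.
  by rewrite -bformT sZ h.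
rewrite -bform_dr /qf.
have -> : col_mx v y = col_mx v (X0 *m v) + col_mx 0 (y - X0 *m v).
  by rewrite add_col_mx addr0 addrC subrK.
by rewrite bformDl !bformDr h h' addr0 add0r.
Qed.

Lemma qf_range E v y :
  (forall a y, bform Z a (col_mx 0 (y - E *m y)) = 0) ->
  qf v y = qf v (E *m y).
Proof.
move=> h; rewrite /qf.
have -> : col_mx v y = col_mx v (E *m y) + col_mx 0 (y - E *m y).
  by rewrite add_col_mx addr0 addrC subrK.
by rewrite bformDr h addr0 bformDl -[X in _ + X]bformT sZ h addr0.
Qed.

Variable Q : 'M[R]_n.
Hypothesis sQ : Q^T = Q.

(** The quadratic matrix inequality [I; X]^T Z [I; X] <= Q; with [X] the transpose
    of [A, B] it describes the systems consistent with the data. *)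
Definition admissible (X : 'M[R]_(k, n)) :=
  forall v, qf v (X *m v) <= bform Q v v.

Variable X1 : 'M[R]_(k, n).
Hypothesis aX1 : admissible X1.

(** A scalar inequality at one nonzero [v] is witnessed by an admissible matrix.
    With the square completed, admissibility of [X] reads
    (X - X0)^T W (X - X0) <= G where G is positive semidefinite, and
    the rank one correction [d *m g^T] suffices, where [g] is normalised by
    g^T v = 1. This is what turns the matrix problem into a problem about two
    scalar quadratic forms. *)
Lemma admissible_through v y : v != 0 -> qf v y <= bform Q v v ->
  exists2 X, admissible X & X *m v = y.
Proof.
move=> v0 vy.
have [X0 h0] := center_exists.
have qc := fun v y => qf_center v y h0.
have pW a : 0 <= bform W a a by rewrite -bform_dr.
pose I0 : 'M[R]_(n + k, n) := col_mx 1%:M X0.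
pose G := Q - I0^T *m Z *m I0.
have GE w : bform G w w = bform Q w w - qf w (X0 *m w).
  by rewrite bformB bform_mul trmxK /qf mul_col_mx mul1mx.
have sG : G^T = G.
  by rewrite linearB /= sQ !trmx_mul trmxK sZ mulmxA.
have pG w : 0 <= bform G w w.
  by rewrite GE subr_ge0 (le_trans _ (aX1 w)) // (qc w (X1 *m w)) lerDl.
set d := y - X0 *m v.
have dG : bform W d d <= bform G v v by rewrite GE lerBrDl -qc.
suff [g gv gP] : exists2 g : 'cV[R]_n, bform 1%:M g v = 1 &
    forall w, bform 1%:M g w ^+ 2 * bform W d d <= bform G w w.
  have gE w : d *m g^T *m w = bform 1%:M g w *: d.
    by rewrite -mulmxA [g^T *m w]mx11_scalar mul_mx_scalar /bform mulmx1.
  exists (X0 + d *m g^T) => [w|]; last first.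
    by rewrite mulmxDl gE gv scale1r addrC subrK.
  rewrite mulmxDl gE qc [_ + _ *: _]addrC addrK bformZl bformZr mulrA -expr2.
  by rewrite -lerBrDl -GE.
(* If v is isotropic for G then d is isotropic for W and any normalised g works;
   otherwise g is proportional to G v and Cauchy-Schwarz for G concludes. *)
have [G0|G0] := eqVneq (bform G v v) 0.
  exists ((bform 1%:M v v)^-1 *: v) => [|w].
    by rewrite bformZl mulVf // bform1_eq0.
  suff -> : bform W d d = 0 by rewrite mulr0.
  by apply/eqP; rewrite eq_le pW andbT -G0.
have {}G0 : 0 < bform G v v by rewrite lt0r G0 pG.
exists ((bform G v v)^-1 *: (G *m v)) => [|w].
  by rewrite bformZl bform1_mulmx sG mulVf ?gt_eqF.
rewrite bformZl bform1_mulmx sG exprMn exprVn.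
have cs := bform_CauchySchwarz v w sG pG.
rewrite -mulrA ler_pdivrMl ?exprn_gt0 //.
apply: (le_trans (ler_wpM2l (sqr_ge0 _) dG)).
by rewrite mulrC expr2 -mulrA ler_pM2l.
Qed.

Lemma admissible_neg (L : 'M[R]_(n, k)) :
  (forall X, admissible X -> forall v, v != 0 -> bform L v (X *m v) < 0) ->
  forall v y, v != 0 -> qf v y <= bform Q v v -> bform L v y < 0.
Proof. by move=> h v y v0 /(admissible_through v0)[X /h + <-]; apply. Qed.

(** The form [L] kills the directions in which the admissible set is unbounded: an
    affine function of [s] that stays negative for every real [s] has zero
    slope. *)
Lemma neg_mul_proj (L : 'M[R]_(n, k)) (E : 'M[R]_k) :
  (forall v y, v != 0 -> qf v y <= bform Q v v -> bform L v y < 0) ->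
  (forall v y, qf v y = qf v (E *m y)) -> E *m E = E ->
  L *m E = L.
Proof.
move=> h qE EE; apply/eqP; rewrite eq_sym -subr_eq0; apply/eqP.
set N := L - _.
have NE y : bform L ^~ (y - E *m y) =1 bform N ^~ y.
  by move=> v; rewrite /bform /N -!mulmxA mulmxBl mulmxBr -mulmxA.
have q0 v y s : qf v (X1 *m v + s *: (y - E *m y)) = qf v (X1 *m v).
  rewrite qE [RHS]qE mulmxDr -scalemxAr mulmxBr [E *m (E *m _)]mulmxA EE subrr.
  by rewrite scaler0 addr0.
have lin v y : v != 0 -> bform N v y = 0.
  move=> v0; apply/eqP/negPn/negP => N0.
  (* the zero of the nonconstant affine function of s *)
  pose s := - bform L v (X1 *m v) / bform N v y.
  have := h v (X1 *m v + s *: (y - E *m y)) v0.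
  by rewrite q0 aX1 bformDr bformZr NE divfK // subrr ltxx => /(_ isT).
apply/matrixP => i j; rewrite mxE.
have d0 : delta_mx i 0 != 0 :> 'cV[R]_n.
  by apply/eqP => /colP /(_ i) /eqP; rewrite !mxE !eqxx oner_eq0.
have := lin _ (delta_mx j 0) d0.
by rewrite /bform trmx_delta -rowE -colE !mxE.
Qed.
End Blocks.
End RealForms.

(** * The strict S-lemma for two quadratic forms *)

(** After a change of sign of [a], the form [M] is nonpositive on the whole ray
    a + s b, s >= 0, along which the form [N] changes sign. *)
Lemma isotropic_between (R : rcfType) p (M N : 'M[R]_p) (a b : 'cV[R]_p) :
  bform M a a <= 0 -> bform M b b <= 0 ->
  bform N a a < 0 -> 0 < bform N b b ->
  exists z, [/\ z != 0, bform M z z <= 0 & bform N z z = 0].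
Proof.
move=> Ma Mb Na Nb.
wlog Mab : a Ma Na / bform M a b + bform M b a <= 0.
  move=> h; have [|/ltW ba] := leP (bform M a b + bform M b a) 0; first exact: h.
  by apply: (h (- a));
    rewrite -scaleN1r !(bformZl, bformZr) ?mulN1r ?opprK //; lra.
set na := bform N a a in Na; set nb := bform N b b in Nb.
set c := bform N a b + bform N b a.
(* s is the positive root of the quadratic polynomial bform N (a + s b). *)
pose D := c ^+ 2 - 4 * na * nb.
have D0 : c ^+ 2 < D by rewrite /D; nra.
have sD : Num.sqrt D ^+ 2 = D.
  by rewrite sqr_sqrtr // (le_trans (sqr_ge0 c)) // ltW.
pose s := (- c + Num.sqrt D) / (2 * nb).
have s0 : 0 < s.
  rewrite divr_gt0 ?mulr_gt0 // addrC subr_gt0.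
  have [c0|c0] := lerP c 0; last first.
    by rewrite -ltr_sqr ?nnegrE ?sqrtr_ge0 ?ltW // sD.
  rewrite (le_lt_trans c0) // sqrtr_gt0 (le_lt_trans (sqr_ge0 c)) //.
have e (P : 'M[R]_p) : bform P (a + s *: b) (a + s *: b) =
   bform P a a + s * (bform P a b + bform P b a) + s ^+ 2 * bform P b b.
  by rewrite !(bformDl, bformDr, bformZl, bformZr); ring.
have Nz : bform N (a + s *: b) (a + s *: b) = 0.
  rewrite e -/na -/nb -/c.
  have sE : s * (2 * nb) = - c + Num.sqrt D.
    by rewrite divfK // mulf_neq0 ?gt_eqF.
  apply: (mulfI (x := 4 * nb)); first by rewrite mulf_neq0 ?gt_eqF.
  rewrite mulr0.
  transitivity ((s * (2 * nb) + c) ^+ 2 - D); first by rewrite /D; ring.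
  by rewrite sE addrAC addNr add0r sD subrr.
exists (a + s *: b); split => //; last by rewrite e; nra.
apply/eqP => /eqP; rewrite addr_eq0 => /eqP aE; move: Na; rewrite /na aE.
rewrite -scaleN1r !(bformZl, bformZr) -/nb; nra.
Qed.

Lemma bform_continuous (R : realType) p (M : 'M[R]_p) :
  continuous (fun z : 'rV[R]_p => bform M z^T z^T).
Proof.
have -> : (fun z : 'rV[R]_p => bform M z^T z^T) =
    (fun z => \sum_i (\sum_j z 0 j * M j i) * z 0 i).
  apply/funext => z; rewrite /bform trmxK mxE; apply: eq_bigr => i _.
  by rewrite !mxE.
have sumC (f : 'I_p -> 'rV[R]_p -> R) : (forall i, continuous (f i)) ->
    continuous (fun z => \sum_i f i z).
  move=> fc z; apply: (@cvg_big _ _ _ _ _ _ _ _ _ (fun i x => f i x)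
    (fun i => f i z) (nbhs_filter z)); first exact: add_continuous.
  by move=> i _; exact: (fc i z).
have colC (i : 'I_p) :
    continuous (fun z : 'rV[R]_p => \sum_j z 0 j * M j i).
  apply: (sumC (fun j z => z 0 j * M j i)) => j z; apply: (@continuousM R).
    exact: coord_continuous.
  exact: cst_continuous.
apply: (sumC (fun i z => (\sum_j z 0 j * M j i) * z 0 i)) => i z.
by apply: (@continuousM R); [exact: colC|exact: coord_continuous].
Qed.

(** By compactness of the unit sphere, the maximum of the two forms is bounded
    below there by a positive constant, which absorbs a small multiple of a third
    form. *)
Lemma max_pos_perturb (R : realType) p (M N P : 'M[R]_p) :
  (forall z, z != 0 -> 0 < Num.max (bform M z z) (bform N z z)) ->
  exists2 d : R, 0 < d & forall e, `|e| < d ->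
    forall z, z != 0 -> 0 < Num.max (bform (M + e *: P) z z) (bform N z z).
Proof.
move=> h; pose S := [set z : 'rV[R]_p | `|z| = 1].
have norm1 (z : 'cV[R]_p) : z != 0 -> S (`|z^T|^-1 *: z^T).
  move=> z0; rewrite /S /= normrZ normfV normr_id mulVf // normr_eq0.
  by rewrite -(inj_eq (@trmx_inj _ _ _)) trmxK trmx0.
have [S0|S0] := pselect (S !=set0); last first.
  by exists 1 => // e _ z /norm1 Sz; case: S0; exists (`|z^T|^-1 *: z^T).
have cS : compact S.
  apply: bounded_closed_compact.
    exists 1; split => // x x1 z; rewrite /S /= => ->; exact: ltW.
  have -> : S = (fun z : 'rV[R]_p => `|z|) @^-1` [set 1] by [].
  by apply: closed_comp; [move=> ? _; exact: norm_continuous|exact: closed_eq].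
have cont (Q : 'M[R]_p) := @bform_continuous R p Q.
have [c cS0 cmin] := EVT_min_rV S0 cS (continuous_subspaceT
  (fun z => continuous_max (cont M z) (cont N z))).
have [b bS0 bmax] := EVT_max_rV S0 cS (continuous_subspaceT
  (fun z => continuous_max (cont P z) (cont (- P) z))).
set m := (_ \max _) c in cmin; set k := (_ \max _) b in bmax.
have m0 : 0 < m.
  apply: h; apply/eqP => c0; move: cS0; rewrite inE /S /= -[c]trmxK c0.
  by rewrite trmx0 normr0 => /esym/eqP; rewrite oner_eq0.
have k0 : 0 <= k.
  by rewrite /k /= bformN le_max oppr_ge0 le_total.
exists (m / (k + 1)); first by rewrite divr_gt0 // ltr_wpDl.
move=> e; rewrite ltr_pdivlMr ?ltr_wpDl // => em z z0.
set y := `|z^T|^-1 *: z^T.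
have Sy : y \in S by rewrite inE; exact: norm1.
have z1 : 0 < `|z^T|.
  by rewrite normr_gt0 -(inj_eq (@trmx_inj _ _ _)) trmxK trmx0.
have zE : z = `|z^T| *: y^T.
  by rewrite /y linearZ /= trmxK scalerA mulfV ?scale1r ?gt_eqF.
have zq (Q : 'M[R]_p) : bform Q z z = `|z^T| ^+ 2 * bform Q y^T y^T.
  by rewrite {1 2}zE bformZl bformZr mulrA.
rewrite !zq -maxr_pMr ?sqr_ge0 // pmulr_rgt0 ?exprn_gt0 //.
have : Num.max (bform P y^T y^T) (bform (- P) y^T y^T) <= k by exact: bmax.
rewrite ge_max => /andP[b1 b2].
have : m <= Num.max (bform M y^T y^T) (bform N y^T y^T) by exact: cmin.
rewrite le_max => b3.
rewrite lt_max bformD bformZ.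
have be : `|e * bform P y^T y^T| < m.
  rewrite normrM (le_lt_trans _ em) // ler_wpM2l // (@le_trans _ _ k) ?lerDl //.
  by rewrite ler_norml -lerNl -bformN b1 b2.
move: be; rewrite ltr_norml => /andP[be _].
case/orP: b3 => b3; apply/orP; [left|right]; lra.
Qed.

(** If no convex combination were positive definite, each one would have a nonzero
    vector where it is nonpositive, and there [M] or [N] is nonpositive too. The
    two sets of parameters so obtained, [S M] and [S N], are closed by
    [max_pos_perturb] and cover [0, 1], so they share the parameter
    sup (S N). At it, [isotropic_between] gives a nonzero vector where both forms
    take the same nonpositive value. *)
Lemma strict_S_lemma (R : realType) p (M N : 'M[R]_p) :
  (forall z, z != 0 -> 0 < Num.max (bform M z z) (bform N z z)) ->
  exists2 l : R, 0 <= l <= 1 &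
    forall z, z != 0 -> 0 < l * bform M z z + (1 - l) * bform N z z.
Proof.
move=> h; apply: contrapT => npd.
pose q l := N + l *: (M - N).
have qE l z : bform (q l) z z = l * bform M z z + (1 - l) * bform N z z.
  by rewrite /q bformD bformZ bformB; ring.
have bad l : 0 <= l <= 1 -> exists2 z, z != 0 & bform (q l) z z <= 0.
  move=> l01; apply: contrapT => nz; apply: npd; exists l => // z z0.
  by rewrite -qE ltNge; apply/negP => qz; apply: nz; exists z.
pose S (P : 'M[R]_p) := [set l | 0 <= l <= 1 /\
  exists z, [/\ z != 0, bform (q l) z z <= 0 & bform P z z <= 0]].
have cover l : 0 <= l <= 1 -> S M l \/ S N l.
  move=> l01; have [z z0 qz] := bad l l01.
  have [Mz|Mz] := leP (bform M z z) 0; first by left; split => //; exists z.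
  right; split => //; exists z; split => //.
  by move: qz; rewrite qE; nra.
have opn P l : 0 <= l <= 1 -> ~ S P l ->
    exists2 d, 0 < d & forall l', `|l' - l| < d -> ~ S P l'.
  move=> l01 nl.
  have [z z0|d d0 dP] := @max_pos_perturb R p (q l) P (M - N).
    rewrite ltNge; apply/negP; rewrite ge_max => /andP[qz Pz].
    by apply: nl; split => //; exists z.
  exists d => // l' l'd [_ [z [z0 qz Pz]]].
  have := dP _ l'd z z0.
  have -> : q l + (l' - l) *: (M - N) = q l'.
    by rewrite /q -addrA -scalerDl [l + _]addrC subrK.
  by rewrite ltNge ge_max qz Pz.
have S0 : S N 0.
  have [|z z0 qz] := bad 0; first by rewrite lexx ler01.
  split; first by rewrite lexx ler01.
  exists z; split => //; move: qz; rewrite qE; lra.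
have ubS : has_sup (S N).
  by split; [exists 0|exists 1 => l [/andP[]]].
set s := sup (S N).
have s01 : 0 <= s <= 1.
  rewrite sup_upper_bound //= ge_sup //; first by case: ubS.
  by move=> l [/andP[]].
have sN : S N s.
  apply: contrapT => /(opn _ _ s01)[d d0 dP].
  have [l Sl ls] := sup_adherent d0 ubS.
  apply: (dP l) => //; rewrite ltr_norml.
  have := sup_upper_bound ubS Sl; rewrite -/s; rewrite -/s in ls; lra.
have sM : S M s.
  apply: contrapT => nM; have [d d0 dP] := opn _ _ s01 nM.
  have [s1|s1] := eqVneq s 1.
    apply: nM; split => //; have [z z0 qz] := bad s s01.
    exists z; split => //; move: qz; rewrite qE s1; lra.
  pose l := s + Num.min (d / 2) (1 - s).
  have l0 : 0 < Num.min (d / 2) (1 - s).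
    by rewrite lt_min divr_gt0 //= subr_gt0 lt_neqAle s1; case/andP: s01.
  have l1 : Num.min (d / 2) (1 - s) <= 1 - s by rewrite ge_min lexx orbT.
  have ld : Num.min (d / 2) (1 - s) <= d / 2 by rewrite ge_min lexx.
  case: (cover l); first by rewrite /l; lra.
    by apply: dP; rewrite /l addrAC subrr add0r gtr0_norm //; lra.
  by move=> /(sup_upper_bound ubS); rewrite -/s /l; lra.
have [_ [a [a0 qa Ma]]] := sM; have [_ [b [b0 qb Nb]]] := sN.
have Na : 0 < bform N a a by have := h _ a0; rewrite lt_max ltNge Ma.
have Mb : 0 < bform M b b.
  by have := h _ b0; rewrite lt_max [X in _ || X]ltNge Nb orbF.
have [||z [z0 qz Dz]] := isotropic_between (N := M - N) qa qb.
- by rewrite bformB; lra.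
- by rewrite bformB; lra.
have := h _ z0; move: Dz; rewrite bformB => /eqP; rewrite subr_eq0 => /eqP Dz.
by rewrite Dz maxxx; move: qz; rewrite qE Dz; lra.
Qed.

Lemma pd_margin (R : realType) p (M P : 'M[R]_p) :
  (forall z, z != 0 -> 0 < bform M z z) ->
  exists2 d : R, 0 < d & forall z, d * bform P z z <= bform M z z.
Proof.
move=> h; have [z z0|d d0 dP] := @max_pos_perturb R p M 0 (- P).
  by rewrite lt_max h.
exists (d / 2) => [|z]; first by rewrite divr_gt0.
have [->|z0] := eqVneq z 0; first by rewrite !bform0l mulr0.
have := dP (d / 2) _ z z0; rewrite gtr0_norm ?divr_gt0 // => /(_ ltac:(lra)).
rewrite lt_max bform0 ltxx orbF bformD bformZ bformN; lra.
Qed.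

(** * The matrix S-lemma *)

Section MatrixSLemma.
Variables (R : realType) (n k : nat) (Z : 'M[R]_(n + k)) (Q : 'M[R]_n).
Variable L : 'M[R]_(n, k).
Hypotheses (sZ : Z^T = Z) (pZ : forall z, 0 <= bform Z z z) (sQ : Q^T = Q).

(** The hypothesis passes to scalar forms by [admissible_neg]. Strictness on all
    nonzero vectors, including those with v = 0, is restored by penalising the
    component [C *m y] of [y] in ker W; [neg_mul_proj] and [range_proj] allow
    replacing [y] by [E *m y], which removes the penalty from the conclusion. *)
Theorem matrix_S_lemma : (exists X, admissible Z Q X) ->
  (forall X, admissible Z Q X -> forall v, v != 0 -> bform L v (X *m v) < 0) ->
  exists a b : R, [/\ 0 < a, 0 < b & forall v y,
    0 <= a * (qf Z v y - bform Q v v) - b * bform 1%:M v v - 2 * bform L v y].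
Proof.
move=> [X1 aX1] hL.
have hS := admissible_neg sZ pZ sQ aX1 hL.
have [E [EE [D ED] EP]] := range_proj sZ pZ.
have qE v y := qf_range sZ v y EP.
have LE := neg_mul_proj aX1 hS qE EE.
(* For n = 0 the strict hypothesis is vacuous and any multiplier works. *)
case: (posnP n) => [n0|n_gt0].
  exists 1, 1; split => // v y.
  have -> : v = 0 by apply/colP => i; move: (ltn_ord i); rewrite {2}n0.
  rewrite !bform0l !mulr0 !subr0 mul1r; exact: pZ.
have [v0 v00] : exists v0 : 'cV[R]_n, v0 != 0.
  exists (const_mx 1); apply/eqP => /colP /(_ (Ordinal n_gt0)) /eqP.
  by rewrite !mxE oner_eq0.
pose C := 1%:M - E.
have CE y : C *m y = y - E *m y by rewrite mulmxBl mul1mx.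
pose M1 := Z - block_mx Q 0 0 0 + block_mx 0 0 0 (C^T *m C).
pose M2 : 'M[R]_(n + k) := block_mx 0 (- 2 *: L) 0 0.
have M1E v y : bform M1 (col_mx v y) (col_mx v y) =
    qf Z v y - bform Q v v + bform 1%:M (C *m y) (C *m y).
  rewrite bformD bformB !bform_block !bform0 !addr0 !add0r.
  by rewrite -[C^T in LHS]mulmx1 bform_mul trmxK.
have M2E v y : bform M2 (col_mx v y) (col_mx v y) = - 2 * bform L v y.
  by rewrite bform_block !bform0 !addr0 !add0r bformZ.
have [z z0|l /andP[l0 l1] lP] := @strict_S_lemma R _ M1 M2.
  rewrite -[z]vsubmxK M1E M2E in z0 *.
  move: (usubmx z) (dsubmx z) z0 => v y z0; rewrite lt_max.
  have [ve|vn] := eqVneq v 0; last first.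
    have [/(hS _ _ vn) Ly|qy] := leP (qf Z v y) (bform Q v v).
      by apply/orP; right; lra.
    by rewrite ltr_wpDr ?subr_gt0 // bform1_ge0.
  rewrite ve bform0l subr0 lt0r addr_ge0 ?pZ ?bform1_ge0 // andbT.
  apply/orP; left; rewrite paddr_eq0 ?pZ ?bform1_ge0 //.
  apply: contraNN z0; rewrite bform1_eq0 CE subr_eq0 => /andP[/eqP Wy /eqP yE].
  rewrite ve (_ : y = 0) ?col_mx0 //; apply/eqP; rewrite -bform1_eq0 {2}yE ED.
  have -> : bform 1%:M y (D *m drsubmx Z *m y) = bform (drsubmx Z) (D^T *m y) y.
    by rewrite /bform trmx_mul trmxK mulmx1 !mulmxA.
  rewrite -(bform_dr Z) psd_radical //; exact/eqP.
(* M1 is nonpositive at (v0, E X1 v0), hence l != 1. *)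
have [|l1'] := eqVneq l 1.
  move=> l1E; have := lP (col_mx v0 (E *m (X1 *m v0))).
  rewrite col_mx_eq0 negb_and v00 l1E M1E CE [E *m (E *m _)]mulmxA EE.
  rewrite subrr bform0l.
  rewrite -qE mul1r subrr mul0r !addr0 => /(_ isT).
  by rewrite subr_gt0 ltNge aX1.
have {}l1 : 0 < 1 - l by rewrite subr_gt0 lt_neqAle l1'.
(* M2 vanishes at (v0, 0), hence l != 0. *)
have {}l0 : 0 < l.
  rewrite lt0r l0 andbT; apply/eqP => l0E; have := lP (col_mx v0 0).
  rewrite col_mx_eq0 negb_and v00 M2E l0E bform0r mul0r !mulr0.
  by rewrite addr0 ltxx => /(_ isT).
have [z z0|d d0 dP] := @pd_margin R _ (l *: M1 + (1 - l) *: M2)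
  (block_mx 1%:M 0 0 0).
  by rewrite bformD !bformZ lP.
exists (l / (1 - l)), (d / (1 - l)); split; rewrite ?divr_gt0 // => v y.
have := dP (col_mx v (E *m y)).
rewrite bformD !bformZ M1E M2E bform_block !bform0 !addr0 CE mulmxA EE subrr.
rewrite bform0l addr0 -qE.
have -> : bform L v (E *m y) = bform L v y.
  by rewrite /bform -mulmxA [L *m (E *m y)]mulmxA LE mulmxA.
move=> h; rewrite -(pmulr_rge0 _ l1).
set A := _ - bform Q v v in h *.
have -> : (1 - l) *
  (l / (1 - l) * A - d / (1 - l) * bform 1%:M v v - 2 * bform L v y) =
  l * A + (1 - l) * (- 2 * bform L v y) - d * bform 1%:M v v.
  by field; rewrite gt_eqF.
by rewrite subr_ge0.
Qed.
End MatrixSLemma.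

(** * Integrals of products of square integrable functions *)

Section L2.
Context (d : measure_display) (X : measurableType d) (R : realType).
Variables (mu : {measure set X -> \bar R}) (D : set X).
Hypothesis mD : measurable D.

Lemma integrable_prod (f g : X -> R) :
  measurable_fun D f -> measurable_fun D g ->
  mu.-integrable D (fun t => (f t ^+ 2)%:E) ->
  mu.-integrable D (fun t => (g t ^+ 2)%:E) ->
  mu.-integrable D (fun t => (f t * g t)%:E).
Proof.
move=> mf mg f2 g2; apply: (le_integrable mD _ _ (integrableD mD f2 g2)).
  by apply/measurable_EFinP; exact: measurable_funM.
move=> t _ /=; rewrite lee_fin [leRHS]ger0_norm ?addr_ge0 ?sqr_ge0 //.
rewrite ler_norml; apply/andP; split; nra.
Qed.

Lemma integrable_lincomb (I : Type) (s : seq I) (f : I -> X -> R) (c : I -> R) :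
  (forall i, mu.-integrable D (fun t => (f i t)%:E)) ->
  mu.-integrable D (fun t => (\sum_(i <- s) c i * f i t)%:E).
Proof.
move=> fi.
have := integrable_sum mD s (P := xpredT)
  (h := fun i t => ((c i)%:E * (f i t)%:E)%E)
  (fun i _ => integrableZl mD (c i) (fi i)).
by apply: eq_integrable => // t _; rewrite -sumEFin.
Qed.

Lemma Rintegral_lincomb (I : Type) (s : seq I) (f : I -> X -> R) (c : I -> R) :
  (forall i, mu.-integrable D (fun t => (f i t)%:E)) ->
  \int[mu]_(t in D) (\sum_(i <- s) c i * f i t) =
  \sum_(i <- s) c i * \int[mu]_(t in D) f i t.
Proof.
move=> fi; elim: s => [|i s IH].
  by under eq_Rintegral do rewrite big_nil; rewrite big_nil Rintegral_cst // mul0r.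
under eq_Rintegral do rewrite big_cons.
rewrite big_cons RintegralD //; last exact: integrable_lincomb.
  by rewrite IH RintegralZl //; exact: fi.
exact: (integrableZl mD (c i) (fi i)).
Qed.
End L2.

(** * Square integrable signals and their Gram matrices *)

Section Signals.
Variables (R : realType) (T : R).
Notation mu := (@completed_lebesgue_measure R).
Notation lebesgueT := (caratheodory_type (wlength (R:=R) idfun)^*%mu).

Lemma measurable_completed (A : set R) : measurable A ->
  measurable (A : set lebesgueT).
Proof. by move=> mA; exact: sub_caratheodory. Qed.

Lemma measurable_seg : measurable (`[0, T]%classic : set lebesgueT).
Proof. by apply: measurable_completed; exact: measurable_itv. Qed.

Lemma completed_seg_lty : (mu `[0%R, T]%classic < +oo)%E.
Proof.
have -> : mu `[0%R, T]%classic = lebesgue_measure `[0%R, T]%classic by [].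
by rewrite lebesgue_measure_itv; case: ifP => // _; rewrite -EFinB ltry.
Qed.

Lemma square_integrable_prod p (v : R -> 'cV[R]_p) i j :
  square_integrable T v ->
  mu.-integrable `[0, T] (fun t => (v t i 0 * v t j 0)%:E).
Proof.
move=> sv; have [mi i2] := sv i; have [mj j2] := sv j.
exact: (integrable_prod measurable_seg).
Qed.

Lemma square_integrable_mulmx p q (M : 'M[R]_(p, q)) (v : R -> 'cV[R]_q) :
  square_integrable T v -> square_integrable T (fun t => M *m v t).
Proof.
move=> sv i; split.
  have -> : (fun t => (M *m v t) i 0) = (fun t => \sum_j M i j * v t j 0).
    by apply/funext => t; rewrite mxE.
  apply: measurable_sum => j; apply: measurable_funM; first exact: measurable_cst.
  exact: (sv j).1.
have -> : (fun t => ((M *m v t) i 0 ^+ 2)%:E) =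
  (fun t => (\sum_(jk : 'I_q * 'I_q)
     (M i jk.1 * M i jk.2) * (v t jk.1 0 * v t jk.2 0))%:E).
  apply/funext => t; congr (_%:E); rewrite mxE expr2 big_distrlr /= pair_bigA /=.
  by apply: eq_bigr => jk _; ring.
apply: (integrable_lincomb measurable_seg) => jk.
exact: square_integrable_prod.
Qed.

Lemma square_integrable_col_mx p q (v : R -> 'cV[R]_p) (w : R -> 'cV[R]_q) :
  square_integrable T v -> square_integrable T w ->
  square_integrable T (fun t => col_mx (v t) (w t)).
Proof.
move=> sv sw i; case: (fintype.split_ordP i) => j ->.
  have e t : col_mx (v t) (w t) (lshift q j) 0 = v t j 0 by rewrite col_mxEu.
  have [mv v2] := sv j; split; first by move: mv; congr (measurable_fun _ _);
    apply/funext => t; rewrite e.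
  by move: v2; congr (_.-integrable _ _); apply/funext => t; rewrite e.
have e t : col_mx (v t) (w t) (rshift p j) 0 = w t j 0 by rewrite col_mxEd.
have [mw w2] := sw j; split; first by move: mw; congr (measurable_fun _ _);
  apply/funext => t; rewrite e.
by move: w2; congr (_.-integrable _ _); apply/funext => t; rewrite e.
Qed.

Lemma gram_sym p (v : R -> 'cV[R]_p) :
  (mx_integral T (fun t => v t *m (v t)^T))^T =
  mx_integral T (fun t => v t *m (v t)^T).
Proof.
apply/matrixP => i j; rewrite !mxE; apply: eq_Rintegral => t _.
by rewrite !mxE !big_ord1 !mxE mulrC.
Qed.

Lemma bform_gram p (v : R -> 'cV[R]_p) (a : 'cV[R]_p) : square_integrable T v ->
  bform (mx_integral T (fun t => v t *m (v t)^T)) a a =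
  \int[mu]_(t in `[0, T]) (a^T *m v t) 0 0 ^+ 2.
Proof.
move=> sv.
have -> : \int[mu]_(t in `[0, T]) (a^T *m v t) 0 0 ^+ 2 =
   \int[mu]_(t in `[0, T]) (\sum_(jk : 'I_p * 'I_p)
     (a jk.1 0 * a jk.2 0) * (v t jk.1 0 * v t jk.2 0)).
  apply: eq_Rintegral => t _; rewrite mxE expr2 big_distrlr /= pair_bigA /=.
  by apply: eq_bigr => jk _; rewrite !mxE; ring.
rewrite (Rintegral_lincomb measurable_seg); last first.
  by move=> jk; exact: square_integrable_prod.
rewrite /bform mxE (eq_bigr (fun k => \sum_j a j 0 * a k 0 *
   \int[mu]_(t in `[0, T]) (v t j 0 * v t k 0))); last first.
  move=> k _; rewrite mxE mulr_suml; apply: eq_bigr => j _.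
  rewrite !mxE mulrAC; congr (_ * _); apply: eq_Rintegral => t _.
  by rewrite mxE big_ord1 mxE.
by rewrite exchange_big pair_bigA.
Qed.

Lemma gram_psd p (v : R -> 'cV[R]_p) (a : 'cV[R]_p) : square_integrable T v ->
  0 <= bform (mx_integral T (fun t => v t *m (v t)^T)) a a.
Proof.
by move=> sv; rewrite bform_gram //; apply: Rintegral_ge0 => t _; exact: sqr_ge0.
Qed.

(** Completeness of the measure makes measurability insensitive to null sets. *)
Lemma ae_eq_square_integrable p (v w : R -> 'cV[R]_p) :
  ae_eq mu `[0, T]%classic v w -> square_integrable T v -> square_integrable T w.
Proof.
move=> vw sv i; have [mv v2] := sv i.
have vwi : ae_eq mu `[0, T]%classic
    (fun t => (v t i 0)%:E) (fun t => (w t i 0)%:E).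
  by apply: filterS vw => t h tT; rewrite h.
have mw : measurable_fun (`[0, T]%classic : set lebesgueT) (fun t => w t i 0).
  apply/measurable_EFinP.
  apply: (ae_measurable_fun completed_lebesgue_measure_is_complete vwi).
  exact/measurable_EFinP.
split=> //.
apply/integrableP; split.
  by apply/measurable_EFinP; exact: measurable_funX.
have /integrableP[mv2] := v2; congr (_ < +oo)%E.
apply: ge0_ae_eq_integral => //.
- exact: measurable_seg.
- exact: measurableT_comp.
- by apply: measurableT_comp => //; apply/measurable_EFinP; exact: measurable_funX.
- by apply: filterS vw => t h tT; rewrite h.
Qed.

Lemma continuous_square_integrable p (v : R -> 'cV[R]_p) :
  {within `[0, T], continuous v} -> square_integrable T v.
Proof.
move=> cv i.
have cvi : {within `[0, T], continuous (fun t => v t i 0)}.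
  apply/subspace_continuousP => t tT.
  apply: (@continuous_cvg _ _ _ _ _ v (fun M : 'cV[R]_p => M i 0)).
    exact: coord_continuous.
  by move/subspace_continuousP : cv; exact.
have cvi2 : {within `[0, T], continuous (fun t => v t i 0 ^+ 2)}.
  apply/subspace_continuousP => t tT.
  apply: (@continuous_cvg _ _ _ _ _ (fun t => v t i 0)
    (fun y : R => y ^+ 2)); first exact: exprn_continuous.
  by move/subspace_continuousP : cvi; exact.
have mcont (f : R -> R) : {within `[0, T], continuous f} ->
    measurable_fun (`[0, T]%classic : set lebesgueT) f.
  move=> cf mD Y mY; apply: measurable_completed.
  exact: subspace_continuous_measurable_fun.
split; first exact: mcont.
apply: measurable_bounded_integrable;
  [exact: measurable_seg|exact: completed_seg_lty|exact: mcont|].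
have /compact_bounded[M [_ hM]] :=
  continuous_compact cvi2 (@segment_compact _ 0 T).
by exists M; split; rewrite ?num_real // => y My t tT; apply: (hM y My); exists t.
Qed.

Lemma bform_gram_ae p (v w : R -> 'cV[R]_p) a :
  ae_eq mu `[0, T]%classic v w -> square_integrable T v ->
  bform (mx_integral T (fun t => v t *m (v t)^T)) a a =
  bform (mx_integral T (fun t => w t *m (w t)^T)) a a.
Proof.
move=> vw sv; have sw := ae_eq_square_integrable vw sv.
have ma (y : R -> 'cV[R]_p) : square_integrable T y ->
    measurable_fun (`[0, T]%classic : set lebesgueT)
      (fun t => ((a^T *m y t) 0 0 ^+ 2)%:E).
  move=> sy; apply/measurable_EFinP; apply: measurable_funX.
  by case: (square_integrable_mulmx a^T sy 0).
rewrite !bform_gram // /Rintegral; congr fine.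
apply: ae_eq_integral; [exact: measurable_seg|exact: ma|exact: ma|].
by apply: filterS vw => t h tT; rewrite h.
Qed.

Lemma bform_gram_mulmx p q (M : 'M[R]_(p, q)) (v : R -> 'cV[R]_q) a :
  square_integrable T v ->
  bform (mx_integral T (fun t => (M *m v t) *m (M *m v t)^T)) a a =
  bform (mx_integral T (fun t => v t *m (v t)^T)) (M^T *m a) (M^T *m a).
Proof.
move=> sv; rewrite (bform_gram _ (square_integrable_mulmx M sv)) (bform_gram _ sv).
by apply: eq_Rintegral => t _; rewrite trmx_mul trmxK mulmxA.
Qed.

End Signals.

Lemma absolutely_continuous_continuous (R : realType) (V : normedModType R)
    (a b : R) (f : R -> V) :
  absolutely_continuous a b f -> {within `[a, b], continuous f}.
Proof.
move=> acf; apply/subspace_continuousP => x; rewrite /= in_itv /= => /andP[ax xb].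
apply/cvgrPdist_lt => e e0; have [d d0 fd] := acf e e0.
have fd1 l r : a <= l -> l <= r -> r <= b -> r - l < d -> `|f r - f l| < e.
  move=> al lr rb rld; have := fd 1%N (fun=> l) (fun=> r).
  by rewrite !big_ord1; apply => // i j _ _ _; rewrite !ord1.
rewrite near_withinE; near=> y => /=; rewrite in_itv /= => /andP[ay yb].
have : `|x - y| < d by near: y; apply: cvgr_dist_lt.
have [xy|yx] := leP x y.
  by rewrite distrC ger0_norm ?subr_ge0 // => ?; rewrite distrC; apply: fd1.
by rewrite ger0_norm ?subr_ge0 ?ltW // => ?; apply: fd1 => //; exact: ltW.
Unshelve. all: by end_near. Qed.

(** * Quadratic forms of the data *)

Section Data.
Variables (R : realType) (n m : nat) (T : R) (Q : 'M[R]_n).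
Variables (x : R -> 'cV[R]_n) (u : R -> 'cV[R]_m).
Notation mu := (@completed_lebesgue_measure R).
Hypothesis sQ : Q^T = Q.

Let Z := mx_integral T (fun t => data_vector x u t *m (data_vector x u t)^T).

Definition residual (A : 'M[R]_n) (B : 'M[R]_(n, m)) (t : R) : 'cV[R]_n :=
  derive1 x t - A *m x t - B *m u t.

Lemma residualE (A : 'M[R]_n) (B : 'M[R]_(n, m)) :
  residual A B = fun t => row_mx 1%:M (row_mx A B) *m data_vector x u t.
Proof.
apply/funext => t; rewrite /data_vector !mul_row_col mul1mx !mulmxN.
by rewrite addrA.
Qed.

(** The residual is [I, A, B] applied to the data vector, so its Gram matrix is
    a congruence transform of the data Gram matrix. *)
Lemma consistent_admissible (A : 'M[R]_n) (B : 'M[R]_(n, m)) :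
  square_integrable T (data_vector x u) ->
  consistent_systems T Q x u (A, B) <-> admissible Z Q (row_mx A B)^T.
Proof.
move=> sz.
have e v :
    bform (mx_integral T (fun t => residual A B t *m (residual A B t)^T)) v v =
    qf Z v ((row_mx A B)^T *m v).
  rewrite residualE bform_gram_mulmx // [in LHS]tr_row_mx.
  by rewrite mul_col_mx trmx1 mul1mx.
rewrite /consistent_systems /= /noise_set /= -/(residual A B); split.
  move=> [_ [_ h]] v; have := h v.
  by rewrite -/(bform _ v v) bformB e subr_ge0.
move=> adm; split; first by rewrite residualE; exact: square_integrable_mulmx.
split; first by rewrite linearB /= sQ gram_sym.
by move=> v; rewrite -/(bform _ v v) bformB e subr_ge0.
Qed.

(** The derivative is square integrable because it agrees almost everywhere with
    As x + Bs u + w, where [x] is continuous; the true system is then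
    consistent, its residual being almost everywhere the noise. *)
Lemma well_behaved_data (As : 'M[R]_n) (Bs : 'M[R]_(n, m)) :
  well_behaved T Q As Bs x u ->
  square_integrable T (data_vector x u) /\ admissible Z Q (row_mx As Bs)^T.
Proof.
move=> [acx su [w [sw [_ wQ]] dxE]].
have sx := continuous_square_integrable (absolutely_continuous_continuous acx).
have sdx : square_integrable T (derive1 x).
  apply: (ae_eq_square_integrable (ae_eq_sym dxE)).
  have -> : (fun t => As *m x t + Bs *m u t + w t) =
      (fun t => row_mx As (row_mx Bs 1%:M) *m col_mx (x t) (col_mx (u t) (w t))).
    by apply/funext => t; rewrite !mul_row_col mul1mx addrA.
  exact: (square_integrable_mulmx _ (square_integrable_col_mx sx
    (square_integrable_col_mx su sw))).
have sN p (v : R -> 'cV[R]_p) : square_integrable T v ->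
    square_integrable T (fun t => - v t).
  move=> /(square_integrable_mulmx (- 1%:M)).
  rewrite (_ : (fun t => _) = fun t => - v t) //; apply/funext => t.
  by rewrite mulNmx mul1mx.
have sz : square_integrable T (data_vector x u).
  exact: (square_integrable_col_mx sdx
    (square_integrable_col_mx (sN _ _ sx) (sN _ _ su))).
split => //; apply/(consistent_admissible As Bs sz).
have sr : square_integrable T (residual As Bs).
  by rewrite residualE; exact: square_integrable_mulmx.
split; first exact: sr.
split; first by rewrite linearB /= sQ gram_sym.
have rw : ae_eq mu `[0, T]%classic (residual As Bs) w.
  apply: filterS dxE => t h tT; rewrite /residual h //.
  by rewrite -addrA -opprD addrAC subrr add0r.
move=> v; rewrite -/(bform _ v v) bformB (bform_gram_ae _ rw sr) -bformB.
exact: wQ.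
Qed.

Lemma closed_loop_form (A : 'M[R]_n) (B : 'M[R]_(n, m)) K (P : 'M[R]_n) v :
  P^T = P ->
  bform ((A + B *m K) *m P + P *m (A + B *m K)^T) v v =
  2 * bform (row_mx P (P *m K^T)) v ((row_mx A B)^T *m v).
Proof.
move=> sP.
have e : P *m (A + B *m K)^T = row_mx P (P *m K^T) *m (row_mx A B)^T.
  by rewrite tr_row_mx mul_row_col linearD /= trmx_mul mulmxDr mulmxA.
rewrite bformD -{1}[(A + _) *m P]trmxK trmx_mul sP bformT e.
rewrite -mulr2n [RHS]mulr_natl; congr (_ *+ 2).
by rewrite /bform !mulmxA.
Qed.

Lemma lmi_form (K : 'M[R]_(m, n)) (P : 'M[R]_n) (beta : R) v y : P^T = P ->
  bform (- block_mx (Q + beta *: 1%:M) (row_mx P (P *m K^T))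
                    (col_mx P (K *m P)) 0 + Z) (col_mx v y) (col_mx v y) =
  qf Z v y - bform Q v v - beta * bform 1%:M v v
  - 2 * bform (row_mx P (P *m K^T)) v y.
Proof.
move=> sP; have -> : col_mx P (K *m P) = (row_mx P (P *m K^T))^T.
  by rewrite tr_row_mx trmx_mul trmxK sP.
rewrite bformD bformN bform_block bform0 bformT bformD bformZ -/(qf Z v y).
ring.
Qed.

Lemma lmi_sym (K : 'M[R]_(m, n)) (P : 'M[R]_n) (beta : R) : P^T = P ->
  (- block_mx (Q + beta *: 1%:M) (row_mx P (P *m K^T))
              (col_mx P (K *m P)) 0 + Z)^T =
  - block_mx (Q + beta *: 1%:M) (row_mx P (P *m K^T))
             (col_mx P (K *m P)) 0 + Z.
Proof.
move=> sP; rewrite linearD linearN /= tr_block_mx gram_sym tr_row_mx tr_col_mx.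
by rewrite !trmx_mul trmxK trmx0 sP linearD linearZ /= trmx1 sQ.
Qed.
End Data.

(** * Informativity for quadratic stabilization *)

Theorem mainTheorem1 (R : realType) (n m : nat) (T : R) (hT : 0 < T)
    (Q : 'M[R]_n) (hQ : loewner_le 0 Q)
    (As : 'M[R]_n) (Bs : 'M[R]_(n, m))
    (x : R -> 'cV[R]_n) (u : R -> 'cV[R]_m)
    (hxu : well_behaved T Q As Bs x u) :
  informative_quadratic_stabilization T Q x u <->
  exists (K : 'M[R]_(m, n)) (P : 'M[R]_n) (beta : R),
    [/\ 0 < beta, loewner_lt 0 P &
        loewner_le 0
          (- block_mx (Q + beta *: 1%:M) (row_mx P (P *m K^T))
                      (col_mx P (K *m P)) 0
           + mx_integral T
               (fun t => data_vector x u t *m (data_vector x u t)^T))].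
Proof.
have sQ : Q^T = Q by case: hQ; rewrite subr0.
have [sz aX1] := well_behaved_data sQ hxu.
have cE A B := consistent_admissible sQ A B sz.
set Z := mx_integral _ _ in aX1 cE *.
split=> [[K [P [[]]]]|[K [P [b [b0 [sP pP] [_ lmi]]]]]].
  rewrite subr0 => sP pP hS.
  pose L := row_mx P (P *m K^T).
  have hL X : admissible Z Q X -> forall v, v != 0 -> bform L v (X *m v) < 0.
    move=> aX v v0.
    have [A [B XE]] : exists A B, X = (row_mx A B)^T.
      by exists (lsubmx X^T), (rsubmx X^T); rewrite hsubmxK trmxK.
    rewrite XE in aX *; have [_ /(_ v v0)] := hS A B ((cE A B).2 aX).
    rewrite -/(bform _ v v) sub0r bformN closed_loop_form //; lra.
  have [a [b [a0 b0 ab]]] := matrix_S_lemma (gram_sym _ _)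
    (fun z => gram_psd z sz) sQ (ex_intro _ _ aX1) hL.
  (* The multiplier a is absorbed by rescaling P; K is unchanged. *)
  have sP' : (a^-1 *: P)^T = a^-1 *: P by rewrite linearZ /= sP.
  exists K, (a^-1 *: P), (b / a); split; first exact: divr_gt0.
    split=> [|v v0]; rewrite subr0 // -/(bform _ v v) bformZ.
    by rewrite mulr_gt0 ?invr_gt0 //; exact: pP.
  split=> [|z]; rewrite subr0; first exact: lmi_sym.
  rewrite -/(bform _ z z) -[z]vsubmxK lmi_form //.
  move: (usubmx z) (dsubmx z) => v y; have h := ab v y.
  rewrite -scalemxAl -scale_row_mx bformZ -(pmulr_rge0 _ a0) -/L -/Z.
  rewrite -/Z in h; set q := qf Z v y - _ in h *.
  have -> : a * (q - b / a * bform 1%:M v v - 2 * (a^-1 * bform L v y)) =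
    a * q - b * bform 1%:M v v - 2 * bform L v y.
    by field; rewrite gt_eqF.
  exact: h.
exists K, P; split; first by split.
rewrite subr0 in sP.
(* The inequality is evaluated at the vectors (v, [A, B]^T v). *)
move=> A B /cE adm; split; rewrite sub0r.
  by rewrite linearN linearD /= !trmx_mul trmxK sP addrC.
move=> v v0; rewrite -/(bform _ v v) bformN closed_loop_form //.
have := lmi (col_mx v ((row_mx A B)^T *m v)).
rewrite subr0 -/(bform _ (col_mx _ _) _) lmi_form //.
have := adm v; have := bform1_gt0 v0; rewrite -/Z; nra.
Qed.
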